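(* The curve $\tilde X_n$ has at least $(p^2-p)\,[\tilde T_n:T_1]$ $\mathbb{F}_{p^2}$-rational points.
   Context: Let $p$ be an odd prime and $K=\mathbb{F}_{p^2}$. Let $T_1=K(x_1)$ be the rational function field, and, inside a fixed separable closure of $T_1$, define recursively $T_m=K(x_1,\dots,x_m)$, where $x_{i+1}$ is a root of $$x_{i+1}^p+x_{i+1}=\frac{x_i^{p+1}}{x_i^p+x_i}.$$ For $n\ge1$ let $\tilde T_n$ be the Galois closure of $T_n$ over $T_1$, and let $\tilde X_n$ be the irreducible complete smooth algebraic curve over $K$ with function field $\tilde T_n$. *)

(* Defs.v *)
From HB Require Import structures.
From mathcomp Require Import all_boot all_order all_algebra all_field.
From mathcomp Require Import boolp classical_sets functions cardinality.

Set Implicit Arguments.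
Unset Strict Implicit.
Unset Printing Implicit Defensive.

Import GRing.Theory.
Local Open Scope ring_scope.
Local Open Scope classical_set_scope.

Section Extensions.
Variables (F Omega : fieldType) (iota : {rmorphism F -> Omega}).

Definition separably_closed (E : fieldType) : Prop :=
  forall q : {poly E}, separable_poly q -> (1 < size q)%N -> exists z, root q z.

Definition separable_over (z : Omega) : Prop :=
  exists2 q : {poly F}, separable_poly q & root (map_poly iota q) z.

Definition separable_closure : Prop :=
  separably_closed Omega /\ forall z, separable_over z.

Definition subfield_generated (A : set Omega) : set Omega :=
  smallest [set E : set Omega | GRing.divring_closed (mem E)] A.

(* The field extension L of F is identified, via the F-embedding j, with the
   subset E of Omega. *)
Definition embeds_onto (L : fieldExtType F) (j : {rmorphism L -> Omega})
    (E : set Omega) : Prop :=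
  (forall a : F, j a%:A = iota a) /\ range j = E.

Definition has_degree (E : set Omega) (d : nat) : Prop :=
  exists (L : fieldExtType F) (j : {rmorphism L -> Omega}),
    embeds_onto j E /\ \dim {:L} = d.

Definition finite_galois (E : set Omega) : Prop :=
  exists (L : splittingFieldType F) (j : {rmorphism L -> Omega}),
    embeds_onto j E /\ galois 1 {:L}.

Definition galois_closure (A : set Omega) : set Omega :=
  smallest finite_galois A.

End Extensions.

(* The closed points of the complete smooth curve with function field E over K
   are the valuation rings of E / K; the residue field of the point is the
   residue field of the valuation ring, and the point is K-rational when this
   residue field is K.  Here E is a subfield of Omega, and K is embedded in E
   by kappa. *)
Section Curve.
Variables (K Omega : fieldType) (kappa : K -> Omega) (E : set Omega).

Definition valuation_ring (O : set Omega) : Prop :=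
  [/\ GRing.subring_closed (mem O), range kappa `<` O, O `<` E
    & forall z, E z -> O z \/ O z^-1].

Definition maximal_ideal (O : set Omega) : set Omega :=
  [set z | O z /\ ~ (z != 0 /\ O z^-1)].

Definition residue_field_is_K (O : set Omega) : Prop :=
  forall z, O z -> exists c : K, maximal_ideal O (z - kappa c).

Definition rational_points : set (set Omega) :=
  [set O | valuation_ring O /\ residue_field_is_K O].

End Curve.

Section Tower.
Variables (p : nat) (K : finFieldType) (Omega : fieldType).
Variable iota : {rmorphism {fraction {poly K}} -> Omega}.

Definition const (c : K) : Omega := iota (tofrac c%:P).

(* The entry x 0 is irrelevant. *)
Definition tower_sequence (x : nat -> Omega) : Prop :=
  x 1%N = iota (tofrac 'X) /\
  forall i, (0 < i)%N ->
    x i.+1 ^+ p + x i.+1 = x i ^+ p.+1 / (x i ^+ p + x i).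

Definition tower (x : nat -> Omega) (m : nat) : set Omega :=
  subfield_generated (range const `|` [set x i | i in [set i | (0 < i <= m)%N]]).

Definition tower_closure (x : nat -> Omega) (n : nat) : set Omega :=
  galois_closure iota (tower x n).

End Tower.

(* Main.v *)
Require Import Defs.
From HB Require Import structures.
From mathcomp Require Import all_boot all_order all_algebra all_field.
From mathcomp Require Import boolp classical_sets functions cardinality.
From mathcomp Require Import ring.

(** The reason for the many points is that the place [x_1 = a] of [T_1] splits
    completely in the tower whenever [a ^ p + a] is nonzero, that is, for at
    least [p ^ 2 - p] elements [a] of [K].  If [x_i] has residue [b] with
    [b ^ p + b] nonzero, then [b ^ (p + 1) / (b ^ p + b)] is a quotient of a norm
    and a trace of [K] over its prime field, so it is a nonzero [c] in the prime
    field; the roots of [Y ^ p + Y = c] are simple and all lie in [K], so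
    [x_{i+1}] again has a residue in [K] of nonzero trace.  A place that splits
    completely in [T_n] splits completely in the Galois closure, of degree [d]
    over [T_1], and thus has [d] rational points above it.

    The splitting is expressed by density.  Fix a valuation ring [V] of the
    Galois closure [L] above [x_1 = a], and put [t = x_1 - a].  The elements of
    [L] that are [t]-adic limits of elements of [T_1] form a subring.  For every
    embedding of [T_n] in [L] over [T_1], the images of the [x_i] satisfy the
    equations of the tower, and [tower_step] shows that they are such limits.
    Since [L] is generated by these conjugates
    ([galois_closure_realization]), [T_1] is dense in [L].  Density gives the
    two facts that are needed: the residue field of [V] is that of [T_1] at
    [a], namely [K] ([place_rational_point]); and an embedding of [L] over [T_1]
    is determined by the image of [V] ([place_image_inj]), so that the [d]
    elements of the Galois group move [V] to [d] distinct points.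

    The valuation ring [V] is a subring maximal among those that contain
    [K[x_1]] and omit [1 / t] ([maximal_subring_valuation]). *)

Set Implicit Arguments.
Unset Strict Implicit.
Unset Printing Implicit Defensive.

Import GRing.Theory.
Local Open Scope ring_scope.
Local Open Scope classical_set_scope.

(** * Subrings given as sets *)

Section SubringSets.
Variable R : nzRingType.
Implicit Types (S : set R) (x y : R).

Lemma subring_setP S : S 1 -> (forall x y, S x -> S y -> S (x - y)) ->
  (forall x y, S x -> S y -> S (x * y)) -> GRing.subring_closed (mem S).
Proof.
move=> S1 SB SM; split=> [|x y|x y]; rewrite ?inE //.
  exact: SB.
exact: SM.
Qed.

Variable S : set R.
Hypothesis ringS : GRing.subring_closed (mem S).

Lemma subring_set1 : S 1.
Proof. by case: ringS => + _ _; rewrite inE. Qed.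

Lemma subring_setB x y : S x -> S y -> S (x - y).
Proof. by case: ringS => _ SB _ Sx Sy; have := SB x y; rewrite !inE; apply. Qed.

Lemma subring_setM x y : S x -> S y -> S (x * y).
Proof. by case: ringS => _ _ SM Sx Sy; have := SM x y; rewrite !inE; apply. Qed.

Lemma subring_set0 : S 0.
Proof. by rewrite -(subrr 1); apply: subring_setB; apply: subring_set1. Qed.

Lemma subring_setN x : S x -> S (- x).
Proof. by rewrite -(sub0r x); apply/subring_setB/subring_set0. Qed.

Lemma subring_setD x y : S x -> S y -> S (x + y).
Proof. by move=> Sx Sy; rewrite -[y]opprK; apply/subring_setB/subring_setN. Qed.

Lemma subring_setX x n : S x -> S (x ^+ n).
Proof.
move=> Sx; elim: n => [|n IHn]; first exact: subring_set1.
by rewrite exprS; apply: subring_setM.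
Qed.

Lemma subring_set_sum (I : Type) (r : seq I) (P : pred I) (f : I -> R) :
  (forall i, P i -> S (f i)) -> S (\sum_(i <- r | P i) f i).
Proof. exact: (big_ind S subring_set0 subring_setD). Qed.

Lemma subring_set_horner (q : {poly R}) x :
  (forall i, S q`_i) -> S x -> S q.[x].
Proof.
move=> Sq Sx; rewrite horner_coef; apply: subring_set_sum => i _.
by apply: subring_setM; last apply: subring_setX.
Qed.

End SubringSets.

(** * Valuation rings as maximal subrings omitting an element *)

Section MaximalSubrings.
Variable L : fieldType.
Implicit Types (S V : set L) (w z t : L).

Definition adjoin_elt S z : set L :=
  [set q.[z] | q in [set q : {poly L} | forall i, S q`_i]].

Lemma adjoin_elt_subring S z : GRing.subring_closed (mem S) ->
  GRing.subring_closed (mem (adjoin_elt S z)).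
Proof.
move=> ringS; apply: subring_setP.
- exists 1; last by rewrite hornerC.
  move=> i; rewrite coef1; case: (_ == _).
    exact: subring_set1.
  exact: subring_set0.
- move=> _ _ [q Sq <-] [r Sr <-]; exists (q - r); last by rewrite !hornerE.
  by move=> i; rewrite coefB; apply: subring_setB.
- move=> _ _ [q Sq <-] [r Sr <-]; exists (q * r); last by rewrite hornerM.
  move=> i; rewrite coefM; apply: subring_set_sum => // k _.
  exact: subring_setM.
Qed.

Lemma sub_adjoin_elt S z : GRing.subring_closed (mem S) ->
  S `<=` adjoin_elt S z.
Proof.
move=> ringS s Ss; exists s%:P; last by rewrite hornerC.
by move=> i; rewrite coefC; case: (_ == _) => //; apply: subring_set0.
Qed.

Lemma mem_adjoin_elt S z : GRing.subring_closed (mem S) -> adjoin_elt S z z.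
Proof.
move=> ringS; exists 'X; last by rewrite hornerX.
move=> i; rewrite coefX; case: (_ == _).
  exact: subring_set1.
exact: subring_set0.
Qed.

(** Zorn's lemma on the subrings that contain [S] and omit [w].  Maximality is
    recorded in the form in which it is used: adjoining any further element
    produces [w]. *)
Lemma exists_maximal_subring S w :
  GRing.subring_closed (mem S) -> ~ S w ->
  exists V, [/\ GRing.subring_closed (mem V), S `<=` V, ~ V w
    & forall z, ~ V z -> adjoin_elt V z w].
Proof.
move=> ringS nSw.
(* The empty set is admitted as a candidate so that the empty chain has an
   upper bound; a maximal candidate is nonempty because [S] is larger. *)
pose good A := [/\ GRing.subring_closed (mem A), S `<=` A & ~ A w].
have [|V [[V0|[ringV sSV nVw]] maxV]] :=
  @Zorn_bigcup L [set A | A = set0 \/ good A].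
- move=> C subC totC.
  have [[A CA gA]|noA] := pselect (exists2 A, C A & good A); last first.
    left; rewrite -subset0 => x [A CA Ax].
    have [A0|gA] := subC A CA; first by rewrite -A0.
    by case: noA; exists A.
  have goodP B x : C B -> B x -> good B.
    by move=> CB Bx; have [B0|//] := subC B CB; rewrite B0 in Bx.
  have pair B B' x y : C B -> C B' -> B x -> B' y ->
    exists D, [/\ C D, good D, D x & D y].
    move=> CB CB' Bx By; have [sBB'|sB'B] := totC _ _ CB CB'.
      by exists B'; split; [|apply: goodP By|apply: sBB'|].
    by exists B; split; [|apply: goodP Bx| |apply: sB'B].
  right; case: (gA) => ringA sSA _; split.
  + apply: subring_setP.
    * by exists A => //; apply: subring_set1.
    * move=> x y [B CB Bx] [B' CB' By].
      have [D [CD [ringD _ _] Dx Dy]] := pair _ _ _ _ CB CB' Bx By.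
      by exists D => //; apply: subring_setB.
    * move=> x y [B CB Bx] [B' CB' By].
      have [D [CD [ringD _ _] Dx Dy]] := pair _ _ _ _ CB CB' Bx By.
      by exists D => //; apply: subring_setM.
  + by move=> x Sx; exists A => //; apply: sSA.
  + by case=> B CB Bw; case: (goodP B w CB Bw).
- case: (maxV S); last by right; split.
  rewrite V0; split=> // /(_ 1 (subring_set1 ringS)); exact.
- exists V; split=> // z nVz; apply: contrapT => nw; case: (maxV (adjoin_elt V z)).
    split; first exact: sub_adjoin_elt.
    by move=> /(_ z (mem_adjoin_elt z ringV)).
  right; split=> //; first exact: adjoin_elt_subring.
  by move=> s /sSV; apply: sub_adjoin_elt.
Qed.

Section MaximalAreValuationRings.
Variables (V : set L) (t : L).
Hypotheses (ringV : GRing.subring_closed (mem V)) (Vt : V t) (nVt : ~ V t^-1).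
Hypothesis maxV : forall z, ~ V z -> adjoin_elt V z t^-1.

Let t_neq0 : t != 0.
Proof.
by apply: contra_notN nVt => /eqP->; rewrite invr0; apply: subring_set0.
Qed.

Let one_notin_tV b : V b -> t * b != 1.
Proof.
move=> Vb; apply: contra_notN nVt => /eqP tb1.
by rewrite -[t^-1]mulr1 -tb1 mulKf.
Qed.

(** If [u = 1 - t b] were not invertible in [V], then [1/t] would be a polynomial
    in [1/u] over [V]; clearing denominators puts a power of [u] in [t V], but
    powers of [u] are congruent to 1 modulo [t V], so [t] would be a unit. *)
Lemma maximal_subring_unit b : V b -> V (1 - t * b)^-1.
Proof.
move=> Vb; set u := 1 - t * b; apply: contrapT => nVu.
have u_neq0 : u != 0.
  by apply: contra_notN nVu => /eqP->; rewrite invr0; apply: subring_set0.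
have Vu : V u.
  by apply: subring_setB => //; [apply: subring_set1|apply: subring_setM].
have uX m : exists2 b', V b' & u ^+ m = 1 - t * b'.
  elim: m => [|m [b' Vb' IHm]].
    by exists 0; [apply: subring_set0|rewrite mulr0 subr0].
  exists (b + b' - t * (b * b')); last by rewrite exprS IHm /u; ring.
  apply: subring_setB => //; first exact: subring_setD.
  by do 2![apply: subring_setM => //].
have [q Vq Dq] := maxV nVu.
have [b' Vb' Du] := uX (size q).
pose s := \sum_(i < size q) q`_i * u ^+ (size q - i).
have Vs : V s.
  apply: subring_set_sum => // i _.
  by apply: subring_setM => //; apply: subring_setX.
have Ds : t * s = u ^+ size q.
  rewrite -[RHS](mulVKf t_neq0); congr (_ * _); rewrite -Dq horner_coef mulr_suml.
  apply: eq_bigr => i _; rewrite -mulrA; congr (_ * _).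
  by rewrite exprVn expfB // mulrC.
have /negP[] := @one_notin_tV (s + b') (subring_setD ringV Vs Vb').
by rewrite mulrDr Ds Du subrK.
Qed.

(** If neither [z] nor [1/z] is in [V], then 1 is [t] times a polynomial in [z]
    and also [t] times a polynomial in [1/z], with coefficients in [V].  As in
    Chevalley's extension theorem, this is refuted by descent on the degrees. *)
Let unit_expansion n z := exists2 c : nat -> L, forall i, V (c i) &
  t * \sum_(i < n.+1) c i * z ^+ i = 1.

Let unit_expansion_mono m n z : (m <= n)%N ->
  unit_expansion m z -> unit_expansion n z.
Proof.
move=> le_mn [c Vc Dc]; exists (fun i => if (i < m.+1)%N then c i else 0).
  by move=> i; case: ifP => _ //; apply: subring_set0.
rewrite -Dc (big_ord_widen n.+1 (fun i => c i * z ^+ i)) // [in RHS]big_mkcond /=.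
by congr (_ * _); apply: eq_bigr => i _; case: ifP; rewrite ?mul0r.
Qed.

(** The relation for [1/z], multiplied by [z ^ (n + 1)] and divided by the unit
    [1 - t r_0], expresses [z ^ (n + 1)] through lower powers of [z]; this
    eliminates the top term of the relation for [z]. *)
Let unit_expansion_descent n z : z != 0 ->
  unit_expansion n.+1 z -> unit_expansion n.+1 z^-1 -> unit_expansion n z.
Proof.
move=> z_neq0 [c Vc Dc] [r Vr Dr].
set u := 1 - t * r 0%N.
have Vu : V u^-1 by apply: maximal_subring_unit.
have u_neq0 : u != 0 by rewrite subr_eq0 eq_sym one_notin_tV.
pose s := \sum_(k < n.+1) r (n.+1 - k)%N * z ^+ k.
have Du : u * z ^+ n.+1 = t * s.
  rewrite mulrBl mul1r -[X in X - _]mulr1 -Dr mulrCA -mulrA -mulrBr.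
  congr (_ * _); rewrite mulr_sumr (reindex_inj rev_ord_inj) big_ord_recr /=.
  rewrite subSS subnn expr0 mulr1 (mulrC (r 0%N)) addrK.
  apply: eq_bigr => k _; rewrite subSS mulrCA exprVn; congr (_ * _).
  have -> : z ^+ n.+1 = z ^+ (n.+1 - k) * z ^+ k.
    by rewrite -exprD subnK // ltnW.
  by rewrite mulrAC mulfV ?mul1r // expf_neq0.
have Dz : z ^+ n.+1 = t * u^-1 * s.
  by rewrite mulrAC -Du mulrC mulKf.
exists (fun i => c i + c n.+1 * (t * u^-1 * r (n.+1 - i)%N)).
  by move=> i; apply: subring_setD => //; do 3!apply: subring_setM => //.
rewrite -Dc [in RHS]big_ord_recr /= Dz /s; congr (_ * _).
rewrite !mulr_sumr -big_split /=; apply: eq_bigr => i _.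
by rewrite mulrDl !mulrA.
Qed.

Let unit_expansion_absurd m n z : z != 0 ->
  unit_expansion m z -> unit_expansion n z^-1 -> False.
Proof.
have base z' : ~ unit_expansion 0 z'.
  case=> c Vc; rewrite big_ord1 expr0 mulr1 => /eqP; exact/negP/one_notin_tV.
have [k] := ubnP (m + n); elim: k => // k IHk in m n z *.
move=> lt_mn z_neq0 Em En; case: m => [|m] in lt_mn Em *; first exact: base Em.
case: n => [|n] in lt_mn En *; first exact: base En.
have [le_mn|lt_nm] := leqP n m.
  apply: (IHk m n.+1 z) => //; apply: unit_expansion_descent => //.
  exact: unit_expansion_mono En.
apply: (IHk m.+1 n z) => //; first by rewrite addnS in lt_mn.
apply: unit_expansion_descent; rewrite ?invr_eq0 // invrK.
by apply: unit_expansion_mono Em; apply: ltnW.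
Qed.

(** Both relations exist by maximality of [V], as [1/t] then lies in [V[z]] and
    in [V[1/z]]. *)
Lemma maximal_subring_valuation z : V z \/ V z^-1.
Proof.
have [->|z_neq0] := eqVneq z 0; first by left; apply: subring_set0.
apply: contrapT => /not_orP[nVz nVz'].
have expand w : ~ V w -> exists n, unit_expansion n w.
  move=> /maxV[q Vq Dq]; exists (size q), (fun i => q`_i) => //.
  by rewrite -horner_coef_wide ?leqnSn // Dq mulfV.
have [[m Em] [n En]] := (expand _ nVz, expand _ nVz').
exact: unit_expansion_absurd Em En.
Qed.

End MaximalAreValuationRings.

End MaximalSubrings.

(** The inverse of an algebraic element is a polynomial in it over the base
    field, so a subring of [L] that contains [F] is a field. *)
Lemma subring_set_inv (F : fieldType) (L : fieldExtType F) (S : set L) (z : L) :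
  GRing.subring_closed (mem S) -> (forall a : F, S a%:A) -> S z -> S z^-1.
Proof.
move=> ringS SF Sz.
have : z^-1 \in <<1; z>>%VS by rewrite memvV memv_adjoin.
case/Fadjoin_polyP=> q /polyOverP q1 ->; apply: subring_set_horner => // i.
by have /vlineP[a ->] := q1 i.
Qed.

(** * Valuation rings are local and integrally closed *)

Section ValuationRing.
Variables (L : fieldType) (V : set L).
Hypothesis ringV : GRing.subring_closed (mem V).
Hypothesis valV : forall z, V z \/ V z^-1.

Local Notation m := (maximal_ideal V).

Lemma maximal_ideal_unit x : V x -> ~ m x -> x != 0 /\ V x^-1.
Proof. by move=> Vx nmx; apply: contrapT => nux; apply: nmx. Qed.

Lemma maximal_idealM x y : V x -> m y -> m (x * y).
Proof.
move=> Vx [Vy nuy]; split; first exact: subring_setM.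
case; rewrite mulf_eq0 => /norP[x_neq0 y_neq0] Vxy; apply: nuy; split=> //.
by rewrite -[y^-1](mulVKf x_neq0) -invfM; apply: subring_setM.
Qed.

(** One of [x / y] and [y / x] is in [V], and [x + y = (x / y + 1) y]. *)
Lemma maximal_idealD x y : m x -> m y -> m (x + y).
Proof.
have [->|x_neq0] := eqVneq x 0; first by rewrite add0r.
have [->|y_neq0] := eqVneq y 0; first by rewrite addr0.
wlog Vxy : x y x_neq0 y_neq0 / V (x / y).
  move=> IH mx my; have [Vxy|] := valV (x / y); first exact: IH.
  by rewrite invf_div addrC => Vyx; apply: IH.
move=> mx my; have -> : x + y = (x / y + 1) * y by field.
apply: maximal_idealM => //; apply: subring_setD => //; exact: subring_set1.
Qed.

Lemma maximal_ideal_prime x y : V x -> V y -> m (x * y) -> m x \/ m y.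
Proof.
move=> Vx Vy [_ nuxy]; apply: contrapT => /not_orP[nmx nmy]; apply: nuxy.
have [x_neq0 Vx'] := maximal_ideal_unit Vx nmx.
have [y_neq0 Vy'] := maximal_ideal_unit Vy nmy.
by rewrite mulf_neq0 // invfM; split=> //; apply: subring_setM.
Qed.

Lemma maximal_ideal1 : ~ m 1.
Proof. by move=> [V1 []]; rewrite invr1 oner_neq0. Qed.

Lemma maximal_ideal_add1 x : m x -> 1 + x != 0 /\ V (1 + x)^-1.
Proof.
move=> mx; have [Vx _] := mx; apply: maximal_ideal_unit.
  by apply: subring_setD => //; apply: subring_set1.
move=> m1x; apply: maximal_ideal1; have -> : 1 = 1 + x + (-1) * x :> L by ring.
apply: maximal_idealD => //; apply: maximal_idealM => //.
exact: subring_setN (subring_set1 ringV).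
Qed.

Lemma maximal_ideal_prod (I : Type) (r : seq I) (f : I -> L) :
  (forall i, V (f i)) -> m (\prod_(i <- r) f i) -> exists i, m (f i).
Proof.
move=> Vf; elim: r => [|i r IHr]; first by rewrite big_nil => /maximal_ideal1.
rewrite big_cons => /maximal_ideal_prime[||mi|/IHr] //; last by exists i.
by apply: (big_ind V) => //; [apply: subring_set1|apply: subring_setM].
Qed.

(** The only case of integral closedness that the tower needs: if [1/y] were in
    [V], dividing the equation by [y ^ (p - 1)] would express [y] over [V]. *)
Lemma artin_schreier_integral (p : nat) (y g : L) :
  (1 < p)%N -> V g -> y ^+ p + y = g -> V y.
Proof.
case: p => [|[|q]] // _ Vg Dg; have [//|Vs] := valV y.
have [->|y_neq0] := eqVneq y 0; first exact: subring_set0.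
have -> : y = g * y^-1 ^+ q.+1 - y^-1 ^+ q.
  rewrite -Dg mulrDl exprVn [y ^+ q.+2]exprS -mulrA mulfV ?expf_neq0 // mulr1.
  by rewrite exprVn exprS invfM mulVKf // addrK.
by apply: subring_setB => //; first apply: subring_setM => //; apply: subring_setX.
Qed.

End ValuationRing.

(** * Places above a rational point of the line *)

Lemma fraction_quotient (R : idomainType) (f : {fraction R}) :
  exists P Q : R, Q != 0 /\ f = tofrac P / tofrac Q.
Proof.
elim/quotW: f => x; exists (frac x).1, (frac x).2.
have nz_d : (frac x).2 != 0 by case: x.
split=> //; apply: (mulIf (_ : tofrac (frac x).2 != 0)).
  by rewrite tofrac_eq0.
rewrite divfK ?tofrac_eq0 //; apply/eqP.
rewrite !piE /FracField.equivf /FracField.mulf.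
by rewrite !numden_Ratio ?mulf_neq0 ?oner_neq0 // !mulr1 mulrC.
Qed.

Section Places.
Variables (K : finFieldType) (L : fieldExtType {fraction {poly K}}).
Local Notation F := {fraction {poly K}}.

Definition poly_elt : {poly K} -> L := in_alg L \o @tofrac {poly K}.
HB.instance Definition _ := GRing.RMorphism.on poly_elt.

Definition const_elt : K -> L := poly_elt \o polyC.
HB.instance Definition _ := GRing.RMorphism.on const_elt.

Definition local_parameter (a : K) : L := poly_elt ('X - a%:P).

Lemma poly_elt_inj : injective poly_elt.
Proof. by move=> P Q /fmorph_inj/eqP; rewrite tofrac_eq => /eqP. Qed.

(** A valuation ring of [L / K] whose centre on the affine line is the point
    [X = a]: it contains [K[X]], and [X - a] is not a unit in it. *)
Definition place_at (a : K) (V : set L) :=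
  [/\ GRing.subring_closed (mem V), range poly_elt `<=` V,
      ~ V (local_parameter a)^-1 & forall z, V z \/ V z^-1].

Lemma exists_place_at a : exists V, place_at a V.
Proof.
have ringP : GRing.subring_closed (mem (range poly_elt)).
  apply: subring_setP; first by exists 1; rewrite ?rmorph1.
    by move=> _ _ [P _ <-] [Q _ <-]; exists (P - Q); rewrite ?rmorphB.
  by move=> _ _ [P _ <-] [Q _ <-]; exists (P * Q); rewrite ?rmorphM.
have nP : ~ range poly_elt (local_parameter a)^-1.
  case=> P _ DP; have: poly_elt (P * ('X - a%:P)) = poly_elt 1.
    rewrite rmorphM /= DP rmorph1 mulVf // -(rmorph0 poly_elt).
    by rewrite (inj_eq poly_elt_inj) polyXsubC_eq0.
  move/poly_elt_inj/(congr1 (horner^~ a))/eqP.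
  by rewrite !hornerE subrr mulr0 eq_sym oner_eq0.
have [V [ringV sPV nV maxV]] := exists_maximal_subring ringP nP.
exists V; split=> // z; apply: (@maximal_subring_valuation _ _ (local_parameter a)) => //.
by apply: sPV; exists ('X - a%:P).
Qed.

Section OnePlace.
Variables (a : K) (V : set L).
Hypothesis placeV : place_at a V.

Local Notation t := (local_parameter a).
Local Notation m := (maximal_ideal V).

Let ringV : GRing.subring_closed (mem V). Proof. by case: placeV. Qed.
Let V1 : V 1 := subring_set1 ringV.
Let V0 : V 0 := subring_set0 ringV.
Let VB := subring_setB ringV.
Let VD := subring_setD ringV.
Let VN := subring_setN ringV.
Let VM := subring_setM ringV.
Let VX := subring_setX ringV.
Let nVt : ~ V t^-1. Proof. by case: placeV. Qed.
Let valV z : V z \/ V z^-1. Proof. by case: placeV => _ _ _ /(_ z). Qed.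
Let Vpoly P : V (poly_elt P). Proof. by case: placeV => _ + _ _; apply; exists P. Qed.
Let Vconst c : V (const_elt c). Proof. exact: Vpoly. Qed.
Let Vt : V t. Proof. exact: Vpoly. Qed.
Let t_neq0 : t != 0.
Proof. by apply: contra_notN nVt => /eqP->; rewrite invr0. Qed.
Let tX_neq0 N : t ^+ N != 0. Proof. exact: expf_neq0. Qed.

Lemma local_parameter_maximal : m t.
Proof. by split=> // -[]. Qed.

(** [vanishes N z] says that [z] lies in [t ^ N V], where [t = X - a]; it plays
    the role of a congruence modulo [t ^ N]. *)
Definition vanishes N z := V (z / t ^+ N).

Lemma vanishes0 N : vanishes N 0.
Proof. by rewrite /vanishes mul0r. Qed.

Lemma vanishesD N x y : vanishes N x -> vanishes N y -> vanishes N (x + y).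
Proof. by rewrite /vanishes mulrDl; apply: VD. Qed.

Lemma vanishesB N x y : vanishes N x -> vanishes N y -> vanishes N (x - y).
Proof. by rewrite /vanishes mulrBl; apply: VB. Qed.

Lemma vanishesMl N x y : V x -> vanishes N y -> vanishes N (x * y).
Proof. by rewrite /vanishes -mulrA; apply: VM. Qed.

Lemma vanishes_le M N x : (M <= N)%N -> vanishes N x -> vanishes M x.
Proof.
move=> le_MN; rewrite /vanishes => VNx.
have -> : x / t ^+ M = x / t ^+ N * t ^+ (N - M).
  by rewrite -[in t ^+ N](subnK le_MN) exprD -mulrA invfM mulrAC mulVf ?mul1r.
by apply: VM => //; apply: VX.
Qed.

Lemma vanishesX k N x : vanishes N x -> vanishes (k * N) (x ^+ k).
Proof. by rewrite /vanishes mulnC exprM -expr_div_n; apply: VX. Qed.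

Lemma vanishes_mem N x : vanishes N x -> V x.
Proof. by move/(vanishes_le (leq0n N)); rewrite /vanishes divr1. Qed.

Lemma vanishes_maximal x : vanishes 1 x -> m x.
Proof.
rewrite /vanishes expr1 => Vx; rewrite -[x](divfK t_neq0).
by apply: maximal_idealM => //; apply: local_parameter_maximal.
Qed.

Lemma const_maximal c : m (const_elt c) -> c = 0.
Proof.
case=> _ nuc; apply/eqP; apply: contra_notT nuc => c_neq0.
by rewrite fmorph_eq0 -fmorphV.
Qed.

Lemma near_const_unit c x : c != 0 -> vanishes 1 (x - const_elt c) ->
  x != 0 /\ V x^-1.
Proof.
move=> c_neq0 Vx; apply: maximal_ideal_unit.
  by rewrite -[x](subrK (const_elt c)); apply: VD => //; apply: vanishes_mem Vx.
move=> mx; move/eqP: c_neq0; apply; apply: const_maximal.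
have -> : const_elt c = x + (-1) * (x - const_elt c) by ring.
apply: maximal_idealD => //; apply: maximal_idealM => //; first exact: VN.
exact: vanishes_maximal.
Qed.

Lemma near_constM c d x y : vanishes 1 (x - const_elt c) ->
  vanishes 1 (y - const_elt d) -> vanishes 1 (x * y - const_elt (c * d)).
Proof.
move=> Vx Vy; have -> : x * y - const_elt (c * d) =
    (y - const_elt d) * (x - const_elt c) + const_elt c * (y - const_elt d)
      + const_elt d * (x - const_elt c) by rewrite rmorphM; ring.
apply: vanishesD; [apply: vanishesD|]; apply: vanishesMl => //.
exact: vanishes_mem Vy.
Qed.

Lemma near_constX c x k : vanishes 1 (x - const_elt c) ->
  vanishes 1 (x ^+ k - const_elt (c ^+ k)).
Proof.
move=> Vx; elim: k => [|k IHk]; last by rewrite !exprS; apply: near_constM.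
by rewrite !expr0 rmorph1 subrr; apply: vanishes0.
Qed.

Lemma near_constV c x : c != 0 -> vanishes 1 (x - const_elt c) ->
  vanishes 1 (x^-1 - const_elt c^-1).
Proof.
move=> c_neq0 Vx; have [x_neq0 Vx'] := near_const_unit c_neq0 Vx.
have -> : x^-1 - const_elt c^-1 =
    (- (x^-1 * const_elt c^-1)) * (x - const_elt c).
  by rewrite fmorphV; field; rewrite fmorph_eq0 c_neq0.
by apply: vanishesMl => //; apply/VN/VM.
Qed.

(** The restriction of the place to [K(X)] is the discrete valuation at [a]: a
    nonzero element is a power of [t] times a unit with residue in [K]. *)
Lemma poly_elt_factor P : P != 0 -> exists k u c, [/\ c != 0,
  vanishes 1 (u - const_elt c) & poly_elt P = t ^+ k * u].
Proof.
move=> P_neq0; have [k [q /implyP/(_ P_neq0) nqa ->]] := multiplicity_XsubC P a.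
exists k, (poly_elt q), q.[a]; split; last by rewrite rmorphM rmorphXn mulrC.
  by rewrite -rootE.
have: root (q - q.[a]%:P) a by rewrite rootE !hornerE subrr.
case/factor_theorem=> r Dr; rewrite /const_elt /= -rmorphB Dr rmorphM.
by rewrite /vanishes expr1 mulfK.
Qed.

Lemma base_elt_factor (f : F) : f != 0 -> exists k l u c, [/\ c != 0,
  vanishes 1 (u - const_elt c) & f%:A * t ^+ l = t ^+ k * u].
Proof.
have [P [Q [Q_neq0 ->]]] := fraction_quotient f; rewrite mulf_eq0 invr_eq0 !tofrac_eq0.
rewrite (negPf Q_neq0) orbF => P_neq0.
have [k [u [c [c_neq0 Vu DP]]]] := poly_elt_factor P_neq0.
have [l [v [d [d_neq0 Vv DQ]]]] := poly_elt_factor Q_neq0.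
have [v_neq0 _] := near_const_unit d_neq0 Vv.
exists k, l, (u / v), (c / d); split.
- by rewrite mulf_neq0 ?invr_eq0.
- exact/near_constM/near_constV.
have -> : (tofrac P / tofrac Q)%:A = poly_elt P / poly_elt Q :> L.
  by rewrite -[_%:A]/(in_alg L _) fmorph_div.
by rewrite DP DQ; field; rewrite v_neq0 tX_neq0.
Qed.

(** An exponent of [t] that is negative would put [1/t] in [V]. *)
Lemma base_elt_residue (f : F) : V f%:A ->
  exists c, vanishes 1 (f%:A - const_elt c).
Proof.
have [->|f_neq0] := eqVneq f 0.
  by exists 0; rewrite scale0r rmorph0 subrr; apply: vanishes0.
have [k [l [u [c [c_neq0 Vu Df]]]]] := base_elt_factor f_neq0 => Vf.
have [u_neq0 Vu'] := near_const_unit c_neq0 Vu.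
have [lt_kl|le_lk] := ltnP k l.
  case: nVt; have -> : t^-1 = f%:A * t ^+ (l - k.+1) * u^-1.
    have Du : u = f%:A * t ^+ (l - k.+1) * t.
      apply: (mulIf (tX_neq0 k)).
      by rewrite mulrC -Df -!mulrA -exprS -exprD subnK.
    have ft_neq0 : f%:A * t ^+ (l - k.+1) != 0 :> L.
      by apply: contraNneq u_neq0 => ft0; rewrite Du ft0 mul0r.
    by rewrite Du invfM mulVKf.
  by apply: VM => //; apply: VM => //; apply: VX.
have {}Df : f%:A = t ^+ (k - l) * u.
  apply: (mulIf (tX_neq0 l)).
  by rewrite Df mulrAC -exprD subnK.
rewrite Df; case: (k - l)%N => [|n]; first by exists c; rewrite mul1r.
exists 0; rewrite rmorph0 subr0 /vanishes expr1 exprSr mulrAC mulfK //.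
apply: VM; first exact: VX.
by rewrite -(subrK (const_elt c) u); apply: VD => //; apply: vanishes_mem Vu.
Qed.

(** The elements with this property form a subring containing [K(X)], that is, a
    subfield; it contains [V], hence everything since [V] is a valuation ring. *)
Lemma bounded_pole z : exists M, V (z * t ^+ M).
Proof.
pose B := [set z | exists M, V (z * t ^+ M)].
have ringB : GRing.subring_closed (mem B).
  apply: subring_setP; first by exists 0%N; rewrite mulr1.
    move=> x y [M VMx] [N VNy]; exists (M + N)%N.
    rewrite mulrBl exprD mulrA [t ^+ M * _]mulrC (mulrA y).
    by apply: VB; apply: VM => //; apply: VX.
  move=> x y [M VMx] [N VNy]; exists (M + N)%N.
  by rewrite exprD mulrACA; apply: VM.
have BF (f : F) : B f%:A.
  have [->|f_neq0] := eqVneq f 0; first by exists 0%N; rewrite scale0r mul0r.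
  have [k [l [u [c [c_neq0 Vu Df]]]]] := base_elt_factor f_neq0.
  exists l; rewrite Df; apply: VM; first exact: VX.
  by rewrite -(subrK (const_elt c) u); apply: VD => //; apply: vanishes_mem Vu.
have [Vz|Vz'] := valV z; first by exists 0%N; rewrite mulr1.
by rewrite -[z]invrK; apply: (subring_set_inv ringB BF); exists 0%N; rewrite mulr1.
Qed.

Lemma vanishes_separated z : (forall N, vanishes N z) -> z = 0.
Proof.
move=> Vz; apply/eqP; apply: contra_notT nVt => z_neq0.
have [M VM'] := bounded_pole z^-1.
have -> : t^-1 = (z^-1 * t ^+ M) * (z / t ^+ M.+1).
  by rewrite exprS mulrACA mulVf // mul1r invfM mulrCA mulfV ?mulr1.
by apply: VM => //; apply: Vz.
Qed.

(** The closure of [K(X)] in [L] for the [t]-adic topology defined by [V].  The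
    place is unramified of degree one with trivial decomposition group when
    this closure is all of [L]. *)
Definition base_closure : set L :=
  [set z | forall N, exists f : F, vanishes N (z - f%:A)].

Lemma base_elt_closure (f : F) : base_closure f%:A.
Proof. by move=> N; exists f; rewrite subrr; apply: vanishes0. Qed.

Lemma base_closure_subring : GRing.subring_closed (mem base_closure).
Proof.
apply: subring_setP.
- by rewrite -(scale1r (1 : L)); apply: base_elt_closure.
- move=> x y Wx Wy N; have [[f Vf] [g Vg]] := (Wx N, Wy N).
  exists (f - g); have -> : x - y - (f - g)%:A = x - f%:A - (y - g%:A).
    by rewrite scalerBl; ring.
  exact: vanishesB.
- move=> x y Wx Wy N; have [[M VMx] [M' VMy]] := (bounded_pole x, bounded_pole y).
  have [f Vf] := Wx (N + M')%N; have [g Vg] := Wy (N + M + M')%N.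
  exists (f * g); have -> : x * y - (f * g)%:A =
     x * (y - g%:A) + y * (x - f%:A) - (x - f%:A) * (y - g%:A).
    by rewrite -[_%:A]/(in_alg L _) rmorphM /=; ring.
  have scale M0 N0 z w : V (z * t ^+ M0) -> vanishes (N0 + M0) w ->
    vanishes N0 (z * w).
    rewrite /vanishes => VMz VNw.
    have -> : z * w / t ^+ N0 = z * t ^+ M0 * (w / t ^+ (N0 + M0)).
      by rewrite exprD; field; rewrite !tX_neq0.
    exact: VM.
  apply: vanishesB; first apply: vanishesD.
  + apply: (scale M) => //; apply: vanishes_le Vg; apply: leq_addr.
  + exact: (scale M').
  + apply: vanishesMl; first exact: vanishes_mem Vf.
    by apply: vanishes_le Vg; rewrite -addnA leq_addr.
Qed.

Section SplittingStep.
Variable p : nat.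
Hypotheses (p_pr : prime p) (cardK : #|K| = (p ^ 2)%N).

Let pcharK : p \in [pchar K].
Proof. exact: card_finPcharP cardK p_pr. Qed.

Let pcharL : p \in [pchar L].
Proof. by rewrite (fmorph_pchar const_elt) pcharK. Qed.

Let frobB (x y : L) : (x - y) ^+ p = x ^+ p - y ^+ p.
Proof. by rewrite -!(pFrobenius_autE pcharL) rmorphB. Qed.

Let frobD (x y : L) : (x + y) ^+ p = x ^+ p + y ^+ p.
Proof. by rewrite -!(pFrobenius_autE pcharL) rmorphD. Qed.

Let p_gt1 : (1 < p)%N. Proof. exact: prime_gt1. Qed.

Let frobK (b : K) : b ^+ p ^+ p = b.
Proof. by rewrite -exprM -[(p * p)%N]/(p ^ 2)%N -cardK expf_card. Qed.

(** If [c] is fixed by Frobenius, then applying Frobenius to [y ^ p + y = c]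
    gives [y ^ (p ^ 2) = y] in the residue field, so the residue of [y] is in the
    field [K] with [p ^ 2] elements.  The residue is a simple root, as the
    derivative of [Y ^ p + Y] is 1, hence the congruence holds modulo [t] and not
    only modulo the maximal ideal. *)
Lemma artin_schreier_residue c y : c ^+ p = c ->
  vanishes 1 (y ^+ p + y - const_elt c) ->
  exists b, b ^+ p + b = c /\ vanishes 1 (y - const_elt b).
Proof.
set h := _ - _ => cp Vh; have Dg : y ^+ p + y = h + const_elt c by rewrite subrK.
have Vy : V y.
  apply: (artin_schreier_integral _ _ _ _ Dg) => //.
  by apply: VD => //; apply: vanishes_mem Vh.
have Vph : vanishes 1 (h ^+ p - h).
  apply: vanishesB => //; rewrite -(prednK (prime_gt0 p_pr)) exprSr.
  by apply: vanishesMl => //; apply: VX; apply: vanishes_mem Vh.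
have Dprod : \prod_b (y - const_elt b) = h ^+ p - h.
  have -> : h ^+ p - h = y ^+ #|K| - y.
    rewrite /h frobB frobD -rmorphXn cp cardK -[(p ^ 2)%N]/(p * p)%N exprM.
    by ring.
  have := congr1 (fun q => (map_poly const_elt q).[y]) (finField_genPoly K).
  rewrite rmorphB rmorph_prod /= map_polyXn map_polyX !hornerE => ->.
  rewrite horner_prod; apply: eq_bigr => b _.
  by rewrite rmorphB /= map_polyX map_polyC !hornerE.
have [b mb] : exists b, m (y - const_elt b).
  apply: (@maximal_ideal_prod _ _ ringV _ (index_enum K)
    (fun b => y - const_elt b)) => [b|].
    exact: VB.
  by rewrite Dprod; apply: vanishes_maximal.
set e := y - const_elt b in mb.
have De : e ^+ p + e = h - const_elt (b ^+ p + b - c).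
  by rewrite /e /h frobB !rmorphB rmorphD rmorphXn /=; ring.
have mep : m (e ^+ p.-1).
  case: (p) p_gt1 => [|[|q]] //= _; rewrite exprSr; apply: maximal_idealM => //.
  by apply: VX; case: mb.
have Dc : b ^+ p + b - c = 0.
  apply: const_maximal; have -> : const_elt (b ^+ p + b - c) =
    h + (-1) * (e ^+ p.-1 * e) + (-1) * e.
    rewrite -exprSr prednK ?prime_gt0 // -[e ^+ p](addrK e) De; ring.
  have N1 : V (-1) by apply: VN.
  do 2?apply: maximal_idealD => //; last exact: maximal_idealM.
    exact: vanishes_maximal.
  by apply: maximal_idealM => //; apply: maximal_idealM => //; case: mep.
exists b; split; first by apply/eqP; rewrite -subr_eq0 Dc.
have [n0 Vu] := maximal_ideal_add1 ringV valV mep.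
rewrite -/e; have -> : e = (1 + e ^+ p.-1)^-1 * h.
  apply: (mulfI n0); rewrite mulVKf // mulrDl mul1r -exprSr.
  by rewrite prednK ?prime_gt0 // addrC De Dc rmorph0 subr0.
exact: vanishesMl.
Qed.

(** One storey of the tower.  If [z] has residue [b] with [b ^ p + b] nonzero,
    then the right-hand side has residue [c], a quotient of the norm of [b] by
    its trace to the prime field; so [c] is a nonzero element of the prime field,
    and the residue [b'] of [y] has trace [c].  To approximate [y] by elements of
    [K(X)], rewrite the equation as [y = g - y ^ p]: the map [f |-> g - f ^ p]
    multiplies the order of the error by [p]. *)
Lemma tower_step b z y : base_closure z -> vanishes 1 (z - const_elt b) ->
  b ^+ p + b != 0 -> y ^+ p + y = z ^+ p.+1 / (z ^+ p + z) ->
  exists b', [/\ b' ^+ p + b' != 0, vanishes 1 (y - const_elt b')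
    & base_closure y].
Proof.
move=> Wz Vz b_neq0 Dy; set w := z ^+ p + z in Dy.
have ringW := base_closure_subring.
pose c := b ^+ p.+1 / (b ^+ p + b).
have b0 : b != 0.
  by apply: contraNneq b_neq0 => ->; rewrite expr0n gtn_eqF ?prime_gt0 // addr0.
have c_neq0 : c != 0 by rewrite mulf_neq0 ?invr_eq0 ?expf_neq0.
have cp : c ^+ p = c.
  rewrite /c expr_div_n -!(pFrobenius_autE pcharK) rmorphD /=.
  rewrite !(pFrobenius_autE pcharK) frobK -exprM mulnC exprM [in RHS]addrC.
  by rewrite exprS frobK [in RHS]exprSr mulrC.
have Vw : vanishes 1 (w - const_elt (b ^+ p + b)).
  rewrite rmorphD /w opprD addrACA; apply: vanishesD => //; exact: near_constX.
have Vg : vanishes 1 (y ^+ p + y - const_elt c).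
  by rewrite Dy; apply: near_constM; [apply: near_constX|apply: near_constV].
have [b' [Db' Vy]] := artin_schreier_residue cp Vg.
exists b'; split=> //; first by rewrite Db'.
have Wg : base_closure (y ^+ p + y).
  rewrite Dy; apply: (subring_setM ringW).
    exact: (subring_setX ringW).
  apply: (subring_set_inv ringW base_elt_closure).
  by apply: (subring_setD ringW) => //; apply: (subring_setX ringW).
suffices approx N : exists f : F, vanishes N.+1 (y - f%:A).
  by move=> N; have [f Vf] := approx N; exists f; apply: vanishes_le Vf.
elim: N => [|N [f Vf]]; first by exists (tofrac b'%:P).
have [f' Vf'] := Wg N.+2; exists (f' - f ^+ p).
have -> : y - (f' - f ^+ p)%:A =
    (y ^+ p + y - f'%:A) - (y - f%:A) ^+ p.
  by rewrite frobB -[_%:A]/(in_alg L _) rmorphB rmorphXn /=; ring.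
apply: vanishesB => //; apply: vanishes_le (vanishesX p Vf).
apply: leq_trans (leq_mul p_gt1 (leqnn N.+1)).
by rewrite mul2n -addnn addSn ltnS leq_addl.
Qed.

End SplittingStep.

Lemma dense_residue z : base_closure z -> V z ->
  exists c, m (z - const_elt c).
Proof.
move=> Wz Vz; have [f Vf] := Wz 1%N.
have VFf : V f%:A.
  by rewrite -[f%:A](subKr z); apply: VB => //; apply: vanishes_mem Vf.
have [c Vc] := base_elt_residue VFf; exists c; apply: vanishes_maximal.
by rewrite -(subrKA f%:A); apply: vanishesD.
Qed.

(** The induction along the tower starts from [y 1 = X], of residue [a]. *)
Lemma tower_in_base_closure p n (y : nat -> L) :
  prime p -> #|K| = (p ^ 2)%N -> a ^+ p + a != 0 ->
  y 1%N = poly_elt 'X ->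
  (forall i, (0 < i < n)%N ->
    y i.+1 ^+ p + y i.+1 = y i ^+ p.+1 / (y i ^+ p + y i)) ->
  forall i, (0 < i <= n)%N -> base_closure (y i).
Proof.
move=> p_pr cardK a_neq0 y1 yS i.
suffices split_i : (0 < i <= n)%N -> exists b, [/\ b ^+ p + b != 0,
    vanishes 1 (y i - const_elt b) & base_closure (y i)].
  by move=> /split_i[b []].
case: i => // i; elim: i => [|i IHi] lt_in.
  exists a; split=> //; last by rewrite y1; apply: (base_elt_closure (tofrac 'X)).
  by rewrite y1 /const_elt /= -rmorphB /vanishes expr1 mulfV.
have [b [b_neq0 Vb Wb]] := IHi (ltnW lt_in).
exact: tower_step Wb Vb b_neq0 (yS i.+1 lt_in).
Qed.

End OnePlace.

Section PlaceImages.
Variables (Omega : fieldType) (psi psi' : {rmorphism L -> Omega}).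

Lemma place_rational_point a V : place_at a V -> (forall z, base_closure a V z) ->
  rational_points (psi \o const_elt) (range psi) (psi @` V).
Proof.
move=> placeV denseV; have [ringV polyV nVt valV] := placeV.
have Vconst c : V (const_elt c) by apply: polyV; exists c%:P.
have psiV z : (psi @` V) (psi z) -> V z by case=> w Vw /fmorph_inj <-.
split; last first.
  move=> _ [z Vz <-]; have [c [Vzc nuzc]] := dense_residue placeV (denseV z) Vz.
  exists c; rewrite /= -rmorphB; split; first by exists (z - const_elt c).
  by rewrite fmorph_eq0 -fmorphV => -[z_neq0 /psiV Vz']; apply: nuzc.
split.
- apply: subring_setP.
  + by exists 1; rewrite ?rmorph1 //; apply: subring_set1.
  + move=> _ _ [z Vz <-] [w Vw <-]; exists (z - w); last by rewrite rmorphB.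
    exact: subring_setB.
  + move=> _ _ [z Vz <-] [w Vw <-]; exists (z * w); last by rewrite rmorphM.
    exact: subring_setM.
- split; first by move=> _ [c _ <-]; exists (const_elt c).
  move=> /(_ (psi (local_parameter a)))[].
    by exists (local_parameter a) => //; apply: polyV; exists ('X - a%:P).
  move=> c _ /= /fmorph_inj/poly_elt_inj/(congr1 (fun P : {poly K} => size P)).
  by rewrite size_XsubC size_polyC; case: (c != 0).
- split; first by move=> _ [z _ <-]; exists z.
  by move=> /(_ (psi (local_parameter a)^-1))[|z Vz /fmorph_inj Dz];
    [exists (local_parameter a)^-1|apply: nVt; rewrite -Dz].
- move=> _ [z _ <-]; have [Vz|Vz] := valV z; [left|right]; first by exists z.
  by exists z^-1 => //; rewrite fmorphV.
Qed.

Hypothesis psi_base : forall f, psi (in_alg L f) = psi' (in_alg L f).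

(** Centres are preserved because both embeddings agree on [K(X)]: if [a] and
    [a'] differ, then [X - a'] is a unit at a place above [a]. *)
Lemma place_image_center a a' V V' : place_at a V -> place_at a' V' ->
  psi @` V = psi' @` V' -> a = a'.
Proof.
move=> placeV placeV' eqV; apply/eqP; apply: contrapT => /negP neq_aa'.
have [_ _ nV' _] := placeV'.
have [] := near_const_unit placeV (c := a - a') (x := local_parameter a').
- by rewrite subr_eq0.
- have -> : local_parameter a' - const_elt (a - a') = local_parameter a.
    by rewrite /const_elt /= -rmorphB polyCB opprB addrA subrK.
  rewrite /vanishes expr1 mulfV //; first by case: placeV => /subring_set1.
  by rewrite -(rmorph0 poly_elt) (inj_eq poly_elt_inj) polyXsubC_eq0.
move=> _ Vt; apply: nV'.
have : (psi' @` V') (psi (local_parameter a')^-1).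
  by rewrite -eqV; exists (local_parameter a')^-1.
by rewrite fmorphV psi_base -fmorphV => -[z Vz /fmorph_inj <-].
Qed.

(** An embedding is continuous for the topology of the place and determined on
    [K(X)], which is dense; so the image of [V] determines the embedding.  For
    two embeddings differing by an automorphism this says that decomposition
    groups are trivial. *)
Lemma place_image_inj a V : place_at a V -> (forall z, base_closure a V z) ->
  range psi `<=` range psi' -> psi @` V = psi' @` V -> psi =1 psi'.
Proof.
move=> placeV denseV sub_range eqV z.
have [w _ Dw] : range psi' (psi z) by apply: sub_range; exists z.
rewrite -Dw; congr (psi' _); apply/eqP; rewrite -subr_eq0; apply/eqP.
apply: (vanishes_separated placeV) => N; have [f Vf] := denseV z N.
suffices Vw : vanishes a V N (w - f%:A).
  by rewrite -(subrKA f%:A) -[f%:A - z]opprB; apply: (vanishesB placeV).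
have : (psi' @` V) (psi ((z - f%:A) / local_parameter a ^+ N)).
  by rewrite -eqV; exists ((z - f%:A) / local_parameter a ^+ N).
rewrite fmorph_div rmorphB rmorphXn /= !psi_base -Dw -rmorphB -rmorphXn.
by rewrite -fmorph_div => -[u Vu /fmorph_inj Du]; rewrite Du in Vu.
Qed.

End PlaceImages.
End Places.

(** * Finite extensions inside a separably closed field *)

Lemma minimal_annihilator (F Omega : fieldType) (iota : {rmorphism F -> Omega})
    (z : Omega) (q : {poly F}) :
  q != 0 -> root (map_poly iota q) z ->
  exists h : {poly F}, [/\ irreducible_poly h, root (map_poly iota h) z
    & forall r, root (map_poly iota r) z -> h %| r].
Proof.
move=> q_neq0 qz.
pose P n := `[< exists h : {poly F},
  [/\ h != 0, root (map_poly iota h) z & size h = n] >].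
have exP : exists n, P n by exists (size q); apply/asboolP; exists q.
have [n /asboolP[h [h_neq0 hz sz_h]] min_n] := ex_minnP exP.
have min_h r : root (map_poly iota r) z -> r != 0 -> (size h <= size r)%N.
  by move=> rz r_neq0; rewrite sz_h; apply: min_n; apply/asboolP; exists r.
exists h; split=> //; first exact/(subfx_irreducibleP hz h_neq0).
move=> r rz; have [//|nhr] := boolP (h %| r).
have : (size h <= size (r %% h)%R)%N.
  apply: min_h => //; move: rz; rewrite {1}(divp_eq r h) rmorphD rmorphM /=.
  by rewrite /root hornerD hornerM (rootP hz) mulr0 add0r.
by rewrite leqNgt ltn_modp h_neq0.
Qed.

(** Simple extensions are adjoined one at a time, each over the previous one.
    That [L] is generated by [rs] is expressed by the last clause, which applies
    directly to subsets of [Omega]; since the elements are algebraic, it is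
    enough to consider subrings. *)
Lemma finite_extension_generated (F Omega : fieldType)
    (iota : {rmorphism F -> Omega}) (rs : seq Omega) :
  (forall z, z \in rs -> exists2 q, q != 0 & root (map_poly iota q) z) ->
  exists (L : fieldExtType F) (j : {rmorphism L -> Omega}),
    [/\ forall c : F, j c%:A = iota c, forall z, z \in rs -> range j z
      & forall S : set Omega, GRing.subring_closed (mem S) ->
          range iota `<=` S -> (forall z, z \in rs -> S z) -> range j `<=` S].
Proof.
elim: rs => [|z rs IHrs] alg_rs.
  exists F^o, iota; split=> [c|//|S _ iotaS _]; last exact: iotaS.
  by congr (iota _); apply: mulr1.
have [z' z'rs|L [j [jF rsL genL]]] := IHrs.
  by apply: alg_rs; rewrite inE z'rs orbT.
have [q q_neq0 qz] := alg_rs z (mem_head z rs).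
have [||h [irr_h hz _]] := @minimal_annihilator _ _ j z (map_poly (in_alg L) q).
- by rewrite map_poly_eq0.
- by rewrite -map_poly_comp (eq_map_poly jF).
pose M : fieldExtType L := SubFieldExtType hz irr_h.
pose j' : {rmorphism baseFieldType M -> Omega} := @subfx_inj L Omega j z h.
have j'L (c : L) : @subfx_inj L Omega j z h (in_alg M c) = j c.
  exact: (subfx_inj_base hz (irredp_neq0 irr_h)).
exists (baseFieldType M), j'; split.
- by move=> c; rewrite -jF -j'L baseField_scaleE.
- move=> z'; rewrite inE => /predU1P[->|/rsL[c _ <-]].
    by exists (subfx_root j z h) => //; apply: (subfx_inj_root hz (irredp_neq0 irr_h)).
  by exists (in_alg M c) => //; apply: j'L.
move=> S ringS iotaS rsS _ [u _ <-].
have [r ->] := subfxE u.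
rewrite /j' /= subfx_inj_eval ?irredp_neq0 //.
apply: subring_set_horner => // [i|]; last by apply: rsS; apply: mem_head.
rewrite coef_map; apply: genL => // z' z'rs; apply: rsS.
by rewrite inE z'rs orbT.
Qed.

Lemma separable_poly_splits (E : fieldType) (q : {poly E}) :
  separably_closed E -> separable_poly q ->
  exists rs, q = lead_coef q *: \prod_(r <- rs) ('X - r%:P).
Proof.
move=> closedE; have [n] := ubnP (size q); elim: n q => // n IHn q lt_qn sep_q.
have q_neq0 : q != 0 by apply: separable_poly_neq0.
have [le_q1|lt_1q] := leqP (size q) 1.
  exists [::]; rewrite big_nil alg_polyC.
  by rewrite [LHS](size1_polyC le_q1) lead_coefE; case: (size q) le_q1 => [|[]].
have [z /factor_theorem[r Dq]] := closedE q sep_q lt_1q.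
have [||rs Dr] := IHn r.
- move: lt_qn; rewrite Dq size_Mmonic ?monicXsubC ?size_XsubC ?addn2 //.
  by apply: contraNneq q_neq0 => r0; rewrite Dq r0 mul0r.
- by apply: dvdp_separable sep_q; rewrite Dq dvdp_mulr.
have Dl : lead_coef q = lead_coef r by rewrite Dq lead_coef_Mmonic ?monicXsubC.
by exists (z :: rs); rewrite big_cons Dl {1}Dq {1}Dr -scalerAl mulrC.
Qed.

(** * The Galois closure as a splitting field *)

Lemma rmorph_range_divring (E Omega : fieldType) (j : {rmorphism E -> Omega}) :
  GRing.divring_closed (mem (range j)).
Proof.
split=> [|x y|x y]; rewrite ?inE.
- by exists 1; rewrite ?rmorph1.
- by move=> [u _ <-] [v _ <-]; exists (u - v); rewrite ?rmorphB.
- by move=> [u _ <-] [v _ <-]; exists (u / v); rewrite ?fmorph_div.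
Qed.

(** The Galois closure is generated by all roots in [Omega] of the minimal
    polynomials of the generators [xs] of [A]: a finite Galois extension that
    contains [A] contains those roots, and they generate the splitting field of
    the product of the minimal polynomials.  The roots are the conjugates of the
    elements of [xs], whence the induction principle in the last clause. *)
Lemma galois_closure_realization (F Omega : fieldType)
    (iota : {rmorphism F -> Omega}) (A : set Omega) (xs : seq Omega) :
  separable_closure iota -> (forall x, x \in xs -> A x) ->
  (forall E : set Omega, GRing.divring_closed (mem E) -> range iota `<=` E ->
     (forall x, x \in xs -> E x) -> A `<=` E) ->
  exists (L : splittingFieldType F) (j : {rmorphism L -> Omega}),
    [/\ embeds_onto iota j (galois_closure iota A), galois 1 {:L},
        forall x, x \in xs -> range j x
      & forall S : set L, GRing.subring_closed (mem S) ->
          (forall c : F, S c%:A) ->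
          (forall (s : gal_of {:L}) y, s \in 'Gal({:L} / 1)%g -> j y \in xs ->
             S (s y)) ->
          forall z, S z].
Proof.
move=> [closedO sepO] xsA genA.
have /choice[h h_min] : forall z, exists h : {poly F}, [/\ separable_poly h,
    root (map_poly iota h) z
  & forall r, root (map_poly iota r) z -> h %| r].
  move=> z; have [q sep_q qz] := sepO z.
  have [h [_ hz min_h]] := minimal_annihilator (separable_poly_neq0 sep_q) qz.
  by exists h; split=> //; apply: dvdp_separable sep_q; apply: min_h.
have /choice[roots roots_h] : forall z, exists rs, map_poly iota (h z) =
    lead_coef (map_poly iota (h z)) *: \prod_(r <- rs) ('X - r%:P).
  move=> z; apply: separable_poly_splits => //.
  by rewrite separable_map; case: (h_min z).
pose rs := flatten [seq roots x | x <- xs].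
have h_neq0 x : h x != 0 by apply: separable_poly_neq0; case: (h_min x).
have lead_neq0 x : lead_coef (map_poly iota (h x)) != 0.
  by rewrite lead_coef_eq0 map_poly_eq0.
have mem_roots x r : (r \in roots x) = root (map_poly iota (h x)) r.
  by rewrite roots_h rootZ // root_prod_XsubC.
have rsP r : reflect (exists2 x, x \in xs & root (map_poly iota (h x)) r)
    (r \in rs).
  apply: (iffP flatten_mapP) => -[x xs_x].
    by rewrite mem_roots => xr; exists x.
  by rewrite -mem_roots => xr; exists x.
have xs_rs x : x \in xs -> x \in rs.
  by move=> xs_x; apply/rsP; exists x => //; case: (h_min x).
have [|L0 [j [jF rsL genL]]] := @finite_extension_generated _ _ iota rs.
  by move=> r /rsP[x _ hr]; exists (h x).
have jFpoly (q : {poly F}) : map_poly j (map_poly (in_alg L0) q) =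
    map_poly iota q.
  by rewrite -map_poly_comp; apply: eq_map_poly => c; apply: jF.
have /choice[g jg] : forall z, exists y, z \in rs -> j y = z.
  move=> z; have [/rsL[y _ <-]|_] := boolP (z \in rs); last by exists 0.
  by exists y.
pose ys := map g rs.
have j_ys : map j ys = rs.
  by rewrite -map_comp -[RHS]map_id; apply/eq_in_map => z /jg.
have genys : <<1 & ys>>%VS = fullv.
  apply/vspaceP=> z; rewrite memvf.
  have [||||y Ky /fmorph_inj<- //] := genL (j @` [set y | y \in <<1 & ys>>%VS])
    _ _ _ (j z).
  - apply: subring_setP; first by exists 1; rewrite ?rmorph1 //= mem1v.
      by move=> _ _ [u Ku <-] [v Kv <-]; exists (u - v); rewrite ?rmorphB //= rpredB.
    by move=> _ _ [u Ku <-] [v Kv <-]; exists (u * v); rewrite ?rmorphM //= rpredM.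
  - by move=> _ [c _ <-]; exists c%:A; rewrite ?jF //= memvZ ?mem1v.
  - move=> r rs_r; exists (g r); last exact: jg.
    by apply: seqv_sub_adjoin; apply: map_f.
  - by exists z.
have splitL : SplittingField.axiom L0.
  exists (\prod_(x <- xs) map_poly (in_alg L0) (h x)).
    by apply: rpred_prod => x _; apply/polyOver1P; exists (h x).
  exists ys => //; rewrite -(eqp_map j).
  have -> : map_poly j (\prod_(y <- ys) ('X - y%:P)) =
      \prod_(r <- rs) ('X - r%:P).
    rewrite rmorph_prod -j_ys [in RHS]big_map; apply: eq_bigr => y _ /=.
    by rewrite rmorphB /= map_polyX map_polyC.
  have -> : map_poly j (\prod_(x <- xs) map_poly (in_alg L0) (h x)) =
      (\prod_(x <- xs) lead_coef (map_poly iota (h x))) *: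
      \prod_(r <- rs) ('X - r%:P).
    rewrite rmorph_prod big_flatten big_map -scaler_prod.
    by apply: eq_bigr => x _; rewrite /= jFpoly -roots_h.
  by rewrite eqp_scale // prodf_seq_neq0; apply/allP => x _; apply: lead_neq0.
pose L : splittingFieldType F :=
  HB.pack L0 (FieldExt_isSplittingField.Build F L0 splitL).
have galL : galois 1 {:L}.
  apply/and3P; split; [exact: sub1v| |exact: normalFieldf].
  rewrite -genys; apply: separable_Fadjoin_seq; apply/allP=> y.
  case/mapP=> r /[dup] rs_r /rsP[x _ hr] ->.
  apply/separable_elementP; exists (map_poly (in_alg L) (h x)); split.
  - by apply/polyOver1P; exists (h x).
  - by rewrite -(fmorph_root j) jFpoly jg.
  - by rewrite separable_map; case: (h_min x).
(* For any model [M] of a Galois extension containing x, the minimal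
   polynomial of x computed in M has all the roots of [h x]. *)
have conj_root (M : splittingFieldType F) (k : {rmorphism M -> Omega}) x y r :
    (forall c : F, k c%:A = iota c) -> k y = x -> root (map_poly iota (h x)) r ->
    root (map_poly k (minPoly 1 y)) r.
  move=> kF ky hr; have /polyOver1P[m Dm] := minPolyOver 1 y.
  have kFpoly q : map_poly k (map_poly (in_alg M) q) = map_poly iota q.
    by rewrite -map_poly_comp; apply: eq_map_poly => c; apply: kF.
  have mx : root (map_poly iota m) x.
    by rewrite -kFpoly -Dm -ky fmorph_root root_minPoly.
  rewrite Dm kFpoly; apply: root_dvdp hr; rewrite dvdp_map.
  by case: (h_min x) => _ _; apply.
have iota_sub (M : fieldExtType F) (k : {rmorphism M -> Omega}) :
    (forall c : F, k c%:A = iota c) -> range iota `<=` range k.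
  by move=> kF _ [c _ <-]; exists c%:A.
exists L, (j : {rmorphism L -> Omega}); split=> //.
- split=> //; apply/seteqP; split; last first.
    apply: smallest_sub; first by exists L, j.
    apply: genA; [exact: rmorph_range_divring|exact: iota_sub|].
    by move=> x /xs_rs/rsL.
  move=> w Lw _ [[M [k [[kF <-] galM]]] sAk].
  have ringk := GRing.divring_closedBM (rmorph_range_divring k).
  apply: genL Lw => // [|r /rsP[x /xsA/sAk[y _ ky] hr]]; first exact: iota_sub.
  have := conj_root M k x y r kF ky hr.
  have [s _ ->] := normalFieldP (normalFieldf 1) y (memvf y).
  rewrite rmorph_prod.
  under eq_bigr do rewrite rmorphB /= map_polyX map_polyC /=.
  rewrite -(big_map k predT (fun w => 'X - w%:P)).
  by rewrite root_prod_XsubC => /mapP[u _ ->]; exists u.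
- by move=> x /xs_rs/rsL.
move=> S ringS FS galS z.
have [||||w Sw /fmorph_inj<- //] := genL (j @` S) _ _ _ (j z).
- apply: subring_setP; first by exists 1; rewrite ?rmorph1 //; apply: subring_set1.
    move=> _ _ [u Su <-] [v Sv <-]; exists (u - v); last by rewrite rmorphB.
    exact: subring_setB.
  move=> _ _ [u Su <-] [v Sv <-]; exists (u * v); last by rewrite rmorphM.
  exact: subring_setM.
- by move=> _ [c _ <-]; exists c%:A.
- move=> r /[dup] rs_r /rsP[x xs_x hr].
  have [y _ jy] := rsL x (xs_rs x xs_x); have jr := jg r rs_r.
  exists (g r) => //.
  have yr : root (minPoly 1 (y : L)) (g r).
    by rewrite -(fmorph_root j) jr; apply: (conj_root L j x y r jF jy hr).
  have [s gal_s <-] :=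
    normalField_root_minPoly (sub1v _) (normalFieldf 1) (memvf (y : L)) yr.
  by apply: galS; rewrite ?jy.
- by exists z.
Qed.

(** * Counting the rational points *)

Lemma finset_card_le (I : finType) (D : {set I}) (T : Type) (B : set T)
    (f : I -> T) :
  (forall i, i \in D -> B (f i)) -> {in D &, injective f} ->
  (`I_#|D| #<= B)%card.
Proof.
move=> fB f_inj; have [->|[i0 Di0]] := set_0Vmem D.
  by rewrite cards0 II0; apply: card_ge0.
pose g k := f (nth i0 (enum D) k).
have enumD k : (k < #|D|)%N -> nth i0 (enum D) k \in D.
  by rewrite cardE => lt_k; rewrite -mem_enum mem_nth.
have g_inj : {in `I_#|D| &, injective g}.
  move=> k l; rewrite !inE => lt_k lt_l /f_inj; rewrite !enumD // => /(_ isT isT).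
  by move/eqP; rewrite nth_uniq ?enum_uniq -?cardE // => /eqP.
apply: card_le_trans (subset_card_le (_ : g @` `I_#|D| `<=` B)).
  by have /card_eqPle[] := inj_card_eq g_inj.
by move=> _ [k lt_k <-]; apply/fB/enumD.
Qed.

(** The polynomial [X ^ p + X] has at most [p] roots. *)
Lemma card_nonzero_trace (p : nat) (K : finFieldType) :
  (1 < p)%N -> (#|K| - p <= #|[set a : K | (a ^+ p + a != 0)%R]%SET|)%N.
Proof.
move=> p_gt1; set D := [set a | _]%SET.
have sz : size ('X^p + 'X : {poly K}) = p.+1.
  by rewrite size_polyDl size_polyXn // size_polyX.
have : (#|~: D| < size ('X^p + 'X : {poly K})%R)%N.
  rewrite cardE; apply: max_poly_roots; last exact: enum_uniq.
    by rewrite -size_poly_eq0 sz.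
  by apply/allP=> a; rewrite mem_enum !inE negbK rootE !hornerE.
by rewrite sz ltnS leq_subLR -(cardsC D) addnC leq_add2r.
Qed.

Section GaloisAction.
Variables (F : fieldType) (L : splittingFieldType F).
Implicit Type s : gal_of {:L}.

Lemma gal_base s (c : F) : s c%:A = c%:A.
Proof. by rewrite linearZ /= rmorph1. Qed.

Lemma gal_surj s z : exists w, s w = z.
Proof.
exists ((s^-1)%g z); rewrite -galM ?memvf //.
by rewrite fingroup.mulVg gal_id.
Qed.

End GaloisAction.

Theorem corollary3p4 (p : nat) (K : finFieldType) (Omega : fieldType)
    (iota : {rmorphism {fraction {poly K}} -> Omega}) (x : nat -> Omega)
    (n : nat) :
  prime p -> odd p -> #|K| = (p ^ 2)%N ->
  separable_closure iota -> tower_sequence p iota x -> (0 < n)%N ->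
  exists2 d : nat, has_degree iota (tower_closure iota x n) d
    & (`I_((p ^ 2 - p) * d) #<= rational_points (const iota) (tower_closure iota x n))%card.
Proof.
move=> p_pr _ cardK closedO [x1 xS] n_gt0.
pose xs := [seq x i | i <- seq.iota 1 n].
have xsP z : reflect (exists2 i, (0 < i <= n)%N & z = x i) (z \in xs).
  apply: (iffP mapP) => -[i]; last first.
    by move=> le_in ->; exists i; rewrite // mem_iota add1n ltnS.
  by rewrite mem_iota add1n ltnS => le_in ->; exists i.
have [||L [j [[jF range_j] galL xs_j genL]]] :=
  @galois_closure_realization _ _ iota (tower iota x n) xs closedO.
- by move=> _ /xsP[i le_in ->]; apply: sub_gen_smallest; right; exists i.
- move=> E ringE iotaE xsE; apply: smallest_sub => // z [[c _ <-]|[i le_in <-]].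
    by apply: iotaE; exists (tofrac c%:P).
  by apply: xsE; apply/xsP; exists i.
rewrite /tower_closure -range_j; exists (\dim {:L}); first by exists L, j.
have /choice[y jy] : forall i, exists z, (0 < i <= n)%N -> j z = x i.
  move=> i; have [le_in|_] := boolP (0 < i <= n)%N; last by exists 0.
  by have [|z _ <-] := xs_j (x i); [apply/xsP; exists i|exists z].
have y1 : y 1%N = poly_elt L 'X.
  by apply: (fmorph_inj j); rewrite jy // x1 -jF.
have yS i : (0 < i < n)%N ->
    y i.+1 ^+ p + y i.+1 = y i ^+ p.+1 / (y i ^+ p + y i).
  case/andP=> i_gt0 lt_in; apply: (fmorph_inj j).
  rewrite fmorph_div !rmorphD !rmorphXn /= !jy ?i_gt0 ?(ltnW lt_in) //.
  exact: xS.
have /choice[V placeV] := @exists_place_at K L.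
have denseV a : a ^+ p + a != 0 -> forall z, base_closure a (V a) z.
  move=> a_neq0; apply: genL.
  - exact: base_closure_subring.
  - exact: base_elt_closure.
  move=> s w _ /xsP[i le_in jw].
  have -> : w = y i by apply: (fmorph_inj j); rewrite jw jy.
  apply: (tower_in_base_closure (placeV a) p_pr cardK a_neq0 (n := n)
    (y := fun i => s (y i))) => // [|k lt_kn].
    by rewrite y1; apply: gal_base.
  by rewrite -!rmorphXn -!rmorphD yS // fmorph_div.
pose psi (s : gal_of {:L}) : {rmorphism L -> Omega} := j \o s.
have psi_base s f : psi s (in_alg L f) = iota f by rewrite /= gal_base jF.
have range_psi s : range (psi s) = range j.
  apply/seteqP; split=> _ [z _ <-]; first by exists (s z).
  by have [w <-] := gal_surj s z; exists w.
pose D := finset.setX [set a : K | a ^+ p + a != 0]%SET 'Gal({:L} / 1)%g.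
have leD : ((p ^ 2 - p) * \dim {:L} <= #|D|)%N.
  rewrite cardsX -(galois_dim galL) dimv1 divn1 leq_mul2r -cardK.
  by rewrite card_nonzero_trace ?prime_gt1 ?orbT.
have le_II : (`I_((p ^ 2 - p) * \dim {:L}) #<= `I_#|D|)%card.
  by rewrite card_le_II.
apply: card_le_trans le_II _.
apply: (finset_card_le (f := fun u => psi u.2 @` V u.1)) => [[a s]|].
  rewrite !inE => /andP[/= a_neq0 _].
  have -> : const iota = psi s \o @const_elt K L.
    by apply/funext => c; symmetry; apply: psi_base.
  by rewrite -(range_psi s); apply: place_rational_point => //; apply: denseV.
move=> [a s] [b t]; rewrite !inE /= => /andP[a_neq0 _] /andP[b_neq0 _] eqV.
have same_base f : psi s (in_alg L f) = psi t (in_alg L f) by rewrite !psi_base.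
have eq_ab := place_image_center same_base (placeV a) (placeV b) eqV.
rewrite -eq_ab in eqV *; congr (_, _); apply/eqP/gal_eqP => z _.
apply: (fmorph_inj j).
apply: (place_image_inj same_base (placeV a) (denseV a a_neq0) _ eqV).
by rewrite !range_psi.
Qed.
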